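(* For all integers $n\geq 0$, $$a_{2^{1}5^{-1}}(5n)>0,\quad a_{2^{1}5^{-1}}(5n+1)=0,\quad a_{2^{1}5^{-1}}(5n+2)<0,\quad a_{2^{1}5^{-1}}(5n+3)=0,\quad a_{2^{1}5^{-1}}(5n+4)<0.$$
   Context: For $|q|<1$ (or as formal power series in $q$) let $f_j:=(q^j;q^j)_\infty=\prod_{k\ge 1}(1-q^{jk})$ for each positive integer $j$. The integers $a_{2^{1}5^{-1}}(n)$, $n\ge 0$, are defined by $\sum_{n=0}^\infty a_{2^{1}5^{-1}}(n)q^n=\dfrac{f_2}{f_5}$. *)

(* Defs.v *)
From mathcomp Require Import all_boot all_order all_algebra.

Set Implicit Arguments.
Unset Strict Implicit.
Unset Printing Implicit Defensive.

Import Order.TTheory GRing.Theory Num.Theory.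
Local Open Scope ring_scope.

(* A formal power series is given by its sequence of coefficients. *)
Definition fps (R : Type) := nat -> R.

Section FormalPowerSeries.

Variable R : comUnitRingType.
Implicit Types u v w : fps R.

Definition fps_mul u v : fps R := fun n => \sum_(i < n.+1) u i * v (n - i)%N.

(* The first n coefficients of v / u, obtained by solving (v / u) * u = v for
   one coefficient at a time; meaningful when u 0 is a unit. *)
Fixpoint fps_div_seq v u n : seq R :=
  if n is m.+1 then
    let s := fps_div_seq v u m in
    rcons s ((v m - \sum_(i < m) s`_i * u (m - i)%N) / u 0%N)
  else [::].

Definition fps_div v u : fps R := fun n => (fps_div_seq v u n.+1)`_n.

Lemma size_fps_div_seq v u n : size (fps_div_seq v u n) = n.
Proof. by elim: n => //= n IHn; rewrite size_rcons IHn. Qed.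

Lemma nth_fps_div_seq v u n i :
  (i < n)%N -> (fps_div_seq v u n)`_i = fps_div v u i.
Proof.
elim: n => // n IHn; rewrite ltnS leq_eqVlt => /predU1P[-> // | lt_in].
by rewrite /= nth_rcons size_fps_div_seq lt_in IHn.
Qed.

Lemma fps_divE v u n :
  fps_div v u n = (v n - \sum_(i < n) fps_div v u i * u (n - i)%N) / u 0%N.
Proof.
rewrite {1}/fps_div /= nth_rcons size_fps_div_seq ltnn eqxx.
by under eq_bigr => i _ do rewrite nth_fps_div_seq //.
Qed.

Lemma fps_divK v u :
  u 0%N \is a GRing.unit -> fps_mul (fps_div v u) u =1 v.
Proof.
move=> u0_unit n; rewrite /fps_mul big_ord_recr /= subnn fps_divE.
by rewrite divrK // addrC subrK.
Qed.

Lemma fps_div_unique v u w :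
  u 0%N \is a GRing.unit -> fps_mul w u =1 v -> w =1 fps_div v u.
Proof.
move=> u0_unit wu_v n; have [m] := ubnP n; elim: m n => // m IHm n lt_nm.
rewrite fps_divE -wu_v /fps_mul big_ord_recr /= subnn addrC.
have -> : \sum_(i < n) w i * u (n - i)%N
        = \sum_(i < n) fps_div v u i * u (n - i)%N.
  by apply: eq_bigr => i _; rewrite IHm // (leq_trans (ltn_ord i)).
by rewrite addrK mulrK.
Qed.

End FormalPowerSeries.

(* For j > 0, f_j = (q^j; q^j)_oo. The factors with k > n do not affect the
   coefficient of q^n (see f_stable), so a finite product determines it. *)
Definition f (j : nat) : fps int :=
  fun n => (\prod_(1 <= k < n.+1) (1 - 'X^(j * k)) : {poly int})`_n.

Lemma f_stable (j n N : nat) : (0 < j)%N -> (n <= N)%N ->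
  (\prod_(1 <= k < N.+1) (1 - 'X^(j * k)) : {poly int})`_n = f j n.
Proof.
move=> j_gt0; elim: N => [|N IHN]; first by rewrite leqn0 => /eqP->.
rewrite leq_eqVlt => /predU1P[-> // | lt_nN].
rewrite big_nat_recr //= mulrBr mulr1 coefB coefMXn ifT; last first.
  by rewrite (leq_trans lt_nN) // leq_pmull.
by rewrite subr0 IHN.
Qed.

Lemma f_coef0 (j : nat) : f j 0 = 1.
Proof. by rewrite /f big_geq // coef1. Qed.

Definition a_2p1_5m1 : fps int := fps_div (f 2) (f 5).

(* Main.v *)
Require Import Defs.
From mathcomp Require Import all_boot all_order all_algebra zify ring.

Set Implicit Arguments.
Unset Strict Implicit.
Unset Printing Implicit Defensive.

Import Order.TTheory GRing.Theory Num.Theory.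
Local Open Scope ring_scope.

(** Since f_5 is a series in q^5, the 5-dissection of f_2 / f_5 is that of
    f_1(q^2). By the pentagonal number theorem
    f_1 = sum of (12/x) q^((x^2 - 1)/24) over x > 0, so x^2 mod 5 shows that
    f_1 = E_0(q^5) - q f_25 + q^2 E_2(q^5), whence the two vanishing classes.
    With [a] = (q^a; q^5)_oo, both components are products:
    E_0 = f_5 [2][3] / ([1][4]) and E_2 = - f_5 [1][4] / ([2][3]).
    By Jacobi's triple product f_5 [2][3] and f_5 [1][4] are theta series, and
    after clearing denominators each identity says that a signed count of the
    representations D = x^2 + 3 y^2 with x, y odd vanishes; a rotation of the
    hexagonal lattice by 60 degrees reverses the sign. The three remaining
    classes of f_2 / f_5 are then, up to sign, inverses of products of factors
    1 - q^k in which 1 - q occurs. *)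

(** * Polynomials modulo X^N, as representatives of power series *)

Definition eqX (N : nat) (p q : {poly int}) :=
  forall i, (i < N)%N -> p`_i = q`_i.

Lemma eqX_refl N p : eqX N p p. Proof. by []. Qed.

Lemma eqX_sym N p q : eqX N p q -> eqX N q p.
Proof. by move=> pq i /pq ->. Qed.

Lemma eqX_trans N q p r : eqX N p q -> eqX N q r -> eqX N p r.
Proof. by move=> pq qr i iN; rewrite pq // qr. Qed.

Lemma eqX_le M N p q : (M <= N)%N -> eqX N p q -> eqX M p q.
Proof. by move=> MN pq i iM; apply: pq (leq_trans iM MN). Qed.

Lemma eqXM N p p' q q' : eqX N p p' -> eqX N q q' -> eqX N (p * q) (p' * q').
Proof.
move=> pp' qq' i iN; rewrite !coefM; apply: eq_bigr => j _.
by rewrite pp' ?qq' //; have := ltn_ord j; lia.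
Qed.

Lemma eqX_sum N I (r : seq I) (P : pred I) F G :
  (forall i, P i -> eqX N (F i) (G i)) ->
  eqX N (\sum_(i <- r | P i) F i) (\sum_(i <- r | P i) G i).
Proof.
by move=> FG j jN; rewrite !coef_sum; apply: eq_bigr => i Pi; apply: FG.
Qed.

Lemma eqX_sumn N m n F G :
  (forall i, (m <= i < n)%N -> eqX N (F i) (G i)) ->
  eqX N (\sum_(m <= i < n) F i) (\sum_(m <= i < n) G i).
Proof. by move=> FG; rewrite !big_nat; apply: eqX_sum. Qed.

(** A constant term 1 makes [c] invertible modulo X^N; strong induction on the index of the
    coefficient. *)
Lemma eqX_mulI N (c p q : {poly int}) : c`_0 = 1 -> eqX N (c * p) (c * q) -> eqX N p q.
Proof.
move=> c0 cpq i; have [m] := ubnP i; elim: m i => // m IHm i im iN.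
have := cpq i iN; rewrite !coefM !big_ord_recl /= c0 !mul1r subn0.
rewrite (_ : \sum_(_ < _) _ =
             \sum_(j < i) c`_(bump 0 j) * q`_(i - bump 0 j)) => [/addIr //|].
apply: eq_bigr => j _; rewrite IHm //; rewrite /bump /=; have := ltn_ord j; lia.
Qed.

Lemma eqXMn N e p q : eqX (N - e) p q -> eqX N ('X^e * p) ('X^e * q).
Proof.
move=> pq i iN; rewrite !coefXnM; case: ltnP => // ei; apply: pq; lia.
Qed.

Lemma eqX_comp N k p q : (0 < k)%N ->
  eqX N p q -> eqX N (p \Po 'X^k) (q \Po 'X^k).
Proof.
move=> k0 pq i iN; rewrite !coef_comp_poly_Xn //; case: ifP => // _.
by apply: pq; apply: leq_ltn_trans iN; apply: leq_div.
Qed.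

(** * Partial products of (q^c; q^d)_oo *)

Definition qP (d c n : nat) : {poly int} :=
  \prod_(0 <= i < n) (1 - 'X^(d * i + c)).

Lemma qPS d c n : qP d c n.+1 = qP d c n * (1 - 'X^(d * n + c)).
Proof. by rewrite /qP big_nat_recr. Qed.

Lemma qP_coef0 d c n : (0 < c)%N -> (qP d c n)`_0 = 1.
Proof.
move=> c0; elim: n => [|n IHn]; first by rewrite /qP big_geq // coef1.
rewrite qPS coef0M IHn coefB coef1 coefXn eqxx mul1r.
by have -> : (0 == d * n + c)%N = false by lia.
Qed.

Lemma qP_stable d c m n N : (m <= n)%N -> (N <= d * m + c)%N ->
  eqX N (qP d c m) (qP d c n).
Proof.
move=> + Nm; elim: n => [|n IHn]; first by rewrite leqn0 => /eqP->.
rewrite leq_eqVlt => /predU1P[-> // | mn]; apply: eqX_trans (IHn mn) _.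
move=> i iN; rewrite qPS mulrBr mulr1 coefB coefMXn ifT ?subr0 //.
have : (d * m <= d * n)%N by rewrite leq_mul2l; lia.
by lia.
Qed.

Lemma qP_comp d c n k : qP d c n \Po 'X^k = qP (k * d) (k * c) n.
Proof.
elim: n => [|n IHn]; first by rewrite /qP !big_geq // comp_polyC.
rewrite !qPS comp_polyM IHn rmorphB /= comp_polyC comp_Xn_poly -exprM.
by congr (_ * (1 - 'X^_)); lia.
Qed.

(** * Gaussian binomial coefficients and Jacobi's triple product *)

(** The Gaussian binomial coefficient, given by the q-Pascal rule so that no division occurs. *)
Fixpoint gauss (R : nzRingType) (Q : R) (m k : nat) : R :=
  match m, k with
  | _, 0%N => 1
  | 0%N, _.+1 => 0
  | m'.+1, k'.+1 => gauss Q m' k'.+1 + Q ^+ (m' - k') * gauss Q m' k'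
  end.

Lemma gauss0r (R : nzRingType) (Q : R) m : gauss Q m 0 = 1.
Proof. by case: m. Qed.

Lemma gauss_small (R : nzRingType) (Q : R) m k : (m < k)%N -> gauss Q m k = 0.
Proof.
elim: m k => [|m IHm] [|k] //= mk.
by rewrite !IHm ?mulr0 ?addr0 //; lia.
Qed.

(** The q-binomial theorem. The form homogeneous in [x] and [y] lets [y] absorb the negative powers
    of q of a bilateral sum. *)
Lemma rothe (R : comNzRingType) (Q x y : R) (m : nat) :
  \prod_(0 <= i < m) (y + x * Q ^+ i) =
  \sum_(0 <= k < m.+1) Q ^+ 'C(k, 2) * gauss Q m k * x ^+ k * y ^+ (m - k).
Proof.
elim: m => [|m IHm].
  by rewrite big_geq // big_nat1 bin_small // !expr0 !mulr1.
rewrite big_nat_recr //= IHm mulrDr.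
rewrite [RHS]big_nat_recl //= subn0 expr0 !mulr1 bin_small // expr0 mul1r.
under [X in _ = _ + X]eq_bigr => k _ do rewrite mulrDr !mulrDl.
rewrite big_split /= addrA; congr (_ + _).
  rewrite big_nat_recl //= subn0 bin_small // gauss0r expr0 !mulr1 mul1r.
  rewrite mulrDl -exprSr; congr (_ + _).
  rewrite [RHS]big_nat_recr //= (@gauss_small _ _ m m.+1) // mulr0 !mul0r addr0.
  rewrite mulr_suml; apply: eq_big_nat => k /andP[_ km].
  by rewrite -!mulrA -exprSr; do 3!congr (_ * _); congr (_ ^+ _); lia.
rewrite mulr_suml; apply: eq_big_nat => k /andP[_ km].
rewrite subSS binS bin1.
have -> : Q ^+ m = Q ^+ k * Q ^+ (m - k) by rewrite -exprD; congr (_ ^+ _); lia.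
by rewrite exprD exprS; ring.
Qed.

Lemma gauss_qP d m k : (k <= m)%N ->
  gauss 'X^d m k * qP d d k * qP d d (m - k) = qP d d m.
Proof.
elim: m k => [|m IHm] [|k] //= km; try by rewrite /qP !big_geq // !mulr1.
  by rewrite subn0 /qP (big_geq (n := 0)) // !mul1r.
rewrite subSS -exprM.
have eX : 'X^(d * k + d) = 'X^d * 'X^(d * k) :> {poly int}.
  by rewrite -exprD; congr ('X^_); lia.
move: km; rewrite ltnS leq_eqVlt => /predU1P[-> | km].
  rewrite gauss_small // subnn muln0 expr0 add0r mul1r.
  have := IHm m (leqnn m); rewrite subnn => E.
  by rewrite !qPS -[in RHS]E; ring.
have E1 := IHm k (ltnW km); have E2 := IHm k.+1 km.
have E3 : qP d d (m - k) = qP d d (m - k.+1) * (1 - 'X^(d * (m - k))).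
  have -> : (m - k = (m - k.+1).+1)%N by lia.
  by rewrite qPS; congr (_ * (1 - 'X^_)); lia.
rewrite [in RHS]qPS.
have -> : 'X^(d * m + d) = 'X^(d * (m - k)) * 'X^(d * k + d) :> {poly int}.
  by rewrite -exprD; congr ('X^_); rewrite addnA -mulnDr subnK // ltnW.
(* The q-Pascal rule, to be combined with 1 - X^(d (m + 1)) = (1 - X^(d (m - k))) + X^(d (m - k)) (1
   - X^(d (k + 1))). *)
transitivity (gauss 'X^d m k.+1 * qP d d k.+1 * qP d d (m - k.+1)
                * (1 - 'X^(d * (m - k)))
  + 'X^(d * (m - k)) * (1 - 'X^(d * k + d))
    * (gauss 'X^d m k * qP d d k * qP d d (m - k))).
  by rewrite !qPS E3; ring.
by rewrite E1 E2; ring.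
Qed.

(** Far from both ends a Gaussian binomial tends to 1 / (q^d; q^d)_oo, since the three products in
    [gauss_qP] agree modulo X^K. *)
Lemma gauss_lim d m k n K : (0 < d)%N -> (K <= k)%N -> (K <= m - k)%N ->
  (k <= m)%N -> (K <= n)%N -> eqX K (gauss 'X^d m k * qP d d n) 1.
Proof.
move=> d0 Kk Kmk km Kn.
have lim j : (K <= j)%N -> eqX K (qP d d j) (qP d d K).
  by move=> Kj; apply: eqX_sym; apply: qP_stable => //; nia.
apply: (@eqX_mulI _ (qP d d K)); first exact: qP_coef0.
rewrite mulr1; apply: (@eqX_trans _ (qP d d m)); last by apply: lim; lia.
rewrite -(gauss_qP d km) mulrC; apply: eqXM; last exact/eqX_sym/lim.
by apply: eqXM (@eqX_refl _ _) _; apply: eqX_trans (lim _ Kn) (eqX_sym (lim _ Kk)).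
Qed.

Lemma sum_fold (R : nmodType) n (F : nat -> R) :
  \sum_(0 <= k < n.*2.+1) F k =
  \sum_(0 <= i < n.+1) F (n + i)%N + \sum_(0 <= i < n) F (n - i.+1)%N.
Proof.
rewrite (big_cat_nat (n := n)) //=; last lia.
rewrite addrC; congr (_ + _).
  rewrite -{1}[n]add0n big_addn; have -> : (n.*2.+1 - n = n.+1)%N by lia.
  by apply: eq_bigr => i _; rewrite addnC.
by rewrite big_nat_rev /=; apply: eq_big_nat => i _; rewrite add0n.
Qed.

Lemma bin2D n i : ('C(n + i, 2) = 'C(n, 2) + 'C(i, 2) + n * i)%N.
Proof.
by elim: i => [|i IHi]; rewrite ?addn0 ?muln0 ?addn0 // addnS !binS !bin1; lia.
Qed.

(** This is [bin2D] at the index -i, where C(-i, 2) = C(i + 1, 2). *)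
Lemma bin2B n i : (i <= n)%N -> ('C(n - i, 2) + n * i = 'C(n, 2) + 'C(i.+1, 2))%N.
Proof.
move=> iin; have [k ->] : exists k, n = (k + i)%N by exists (n - i)%N; lia.
rewrite addnK bin2D binS bin1.
have : (i * i = 'C(i, 2).*2 + i)%N; last by nia.
by elim: i {iin} => // i IHi; rewrite binS bin1; nia.
Qed.

(* The terms of index i >= 0 and -(i + 1) < 0 of a bilateral theta sum, with
   coefficients c1 and c2. *)
Definition theta_sum (a b n : nat) (c1 c2 : nat -> {poly int}) : {poly int} :=
  \sum_(0 <= i < n.+1) (-1) ^+ i * 'X^((a + b) * 'C(i, 2) + a * i) * c1 i
  + \sum_(0 <= i < n)
      (-1) ^+ i.+1 * 'X^((a + b) * 'C(i.+1, 2) + b * i.+1) * c2 i.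

(** A factor with i < n is -X^((a + b) i + a) times a factor of [qP (a + b) b n]; a factor with i >=
    n is X^((a + b) n) times one of [qP (a + b) a n]. *)
Lemma prod_rothe a b n :
  \prod_(0 <= i < n.*2) ('X^((a + b) * n) + - 'X^a * ('X^(a + b)) ^+ i) =
  (-1) ^+ n * 'X^((a + b) * ('C(n, 2) + n * n) + a * n)
    * (qP (a + b) a n * qP (a + b) b n) :> {poly int}.
Proof.
rewrite (big_cat_nat (n := n)) //=; last lia.
rewrite -{3}[n]add0n big_addn; have -> : (n.*2 - n = n)%N by lia.
have -> : \prod_(0 <= i < n) ('X^((a + b) * n)
                              + - 'X^a * ('X^(a + b)) ^+ i : {poly int}) =
    (-1) ^+ n * 'X^((a + b) * 'C(n, 2) + a * n) * qP (a + b) b n.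
  have -> : qP (a + b) b n
      = \prod_(0 <= i < n) (1 - 'X^((a + b) * (n - i.+1) + b)).
    by rewrite /qP big_nat_rev /=; apply: eq_big_nat => i _; rewrite add0n.
  have -> : (-1) ^+ n * 'X^((a + b) * 'C(n, 2) + a * n)
      = \prod_(0 <= i < n) - 'X^((a + b) * i + a) :> {poly int}.
    elim: n => [|n IHn].
      by rewrite big_geq // bin_small // !muln0 !expr0 mulr1.
    rewrite big_nat_recr //= -IHn exprS binS bin1 mulrN mulN1r mulNr.
    rewrite -[in RHS]mulrA -exprD; congr (- (_ * 'X^_)); lia.
  rewrite -big_split /=; apply: eq_big_nat => i /andP[_ lin].
  rewrite !mulNr mulrBr mulr1 opprB -exprM -!exprD.
  by congr ('X^_ - 'X^_); nia.
have -> : \prod_(0 <= i < n) ('X^((a + b) * n)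
                              + - 'X^a * ('X^(a + b)) ^+ (i + n) : {poly int}) =
    'X^((a + b) * (n * n)) * qP (a + b) a n.
  have -> : 'X^((a + b) * (n * n))
      = \prod_(0 <= i < n) 'X^((a + b) * n) :> {poly int}.
    by rewrite prodr_const_nat subn0 -exprM mulnA.
  rewrite -big_split /=; apply: eq_big_nat => i _.
  rewrite mulrBr mulr1 -exprM mulNr -!exprD.
  by congr ('X^_ - 'X^_); lia.
rewrite [((a + b) * ('C(n, 2) + n * n))%N]mulnDr addnAC !exprD; ring.
Qed.

(** Rothe's identity at Q = X^(a + b), x = -X^a, y = X^((a + b) n), recentred at k = n; the monomial
    of [prod_rothe] then cancels. *)
Lemma finite_jacobi a b n :
  qP (a + b) a n * qP (a + b) b n =
  theta_sum a b n (fun i => gauss 'X^(a + b) n.*2 (n + i))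
                  (fun i => gauss 'X^(a + b) n.*2 (n - i.+1)).
Proof.
set B := ((a + b) * ('C(n, 2) + n * n) + a * n)%N.
have B_neq0 : (-1) ^+ n * 'X^B != 0 :> {poly int}.
  by rewrite mulf_neq0 ?signr_eq0 // -size_poly_gt0 size_polyXn.
apply: (mulfI B_neq0); rewrite -prod_rothe rothe sum_fold /theta_sum mulrDr.
have sgnE k e (g : {poly int}) : 'X^e * g * (- 'X^a) ^+ k * 'X^((a + b) * n) ^+ (n.*2 - k)
    = (-1) ^+ k * 'X^(e + a * k + (a + b) * n * (n.*2 - k)) * g.
  rewrite (exprNn 'X^a) -!exprM !exprD; ring.
rewrite !mulr_sumr; congr (_ + _); apply: eq_big_nat => i lin.
  rewrite -exprM sgnE !mulrA; congr (_ * _).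
  rewrite exprD -!mulrA (mulrCA 'X^B) -exprD; congr (_ * (_ * 'X^_)).
  rewrite bin2D /B; move: 'C(n, 2) 'C(i, 2) => u v.
  have [m nE] : exists m, n = (i + m)%N by exists (n - i)%N; lia.
  have -> : (n.*2 - (n + i) = m)%N by lia.
  by rewrite nE; ring.
rewrite -exprM sgnE !mulrA; congr (_ * _).
have -> : (-1) ^+ (n - i.+1) = (-1) ^+ n * (-1) ^+ i.+1 :> {poly int}.
  by rewrite -exprD -signr_odd -[RHS]signr_odd oddD oddB //; lia.
rewrite -!mulrA (mulrCA 'X^B) -exprD; congr (_ * (_ * 'X^_)).
rewrite /B; have := @bin2B n i.+1; rewrite (binS i.+1) bin1.
move: 'C(n, 2) 'C(i.+1, 2) 'C(n - i.+1, 2) => u v w.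
have [m nE] : exists m, n = (i.+1 + m)%N by exists (n - i.+1)%N; lia.
have -> : (n.*2 - (n - i.+1) = n + i.+1)%N by lia.
have -> : (n - i.+1 = m)%N by lia.
rewrite nE => /(_ (leq_addr _ _)) /(congr1 (muln (a + b))) E.
lia.
Qed.

Lemma jacobi a b n : (0 < a)%N -> (0 < b)%N ->
  eqX n (qP (a + b) a n * qP (a + b) b n * qP (a + b) (a + b) n)
        (theta_sum a b n (fun=> 1) (fun=> 1)).
Proof.
move=> a0 b0; rewrite finite_jacobi mulrDl.
(* At distance at most [k] from the centre the Gaussian binomial is known only modulo X^(n - k); the
   monomial in front, of degree at least [k], makes up for the loss. *)
have lim k e g (j : nat) : (k <= n)%N -> (k <= e)%N ->
    (n - k <= g <= n + k)%N ->
    eqX n ((-1) ^+ j * 'X^e * gauss 'X^(a + b) n.*2 g * qP (a + b) (a + b) n)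
          ((-1) ^+ j * 'X^e * 1).
  move=> kn ke gE; rewrite -!mulrA; apply: eqXM => //; apply: eqXMn.
  by apply: (@eqX_le _ (n - k)); [lia | apply: gauss_lim; lia].
have step (p p' q q' : {poly int}) :
    eqX n p p' -> eqX n q q' -> eqX n (p + q) (p' + q').
  by move=> pp' qq' i iN; rewrite !coefD pp' ?qq'.
rewrite !mulr_suml; apply: step; apply: eqX_sumn => i iN.
  by apply: (@lim i); first lia; last lia; rewrite -[leqLHS]add0n leq_add // leq_pmull.
by apply: (@lim i.+1); first lia; last lia; rewrite -[leqLHS]add0n leq_add // leq_pmull.
Qed.

(** * Theta coefficients as sums over square roots *)

Lemma sum_nat_trunc (R : nmodType) m n (F : nat -> R) : (m <= n)%N ->
  (forall y, (m <= y < n)%N -> F y = 0) ->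
  \sum_(0 <= y < n) F y = \sum_(0 <= y < m) F y.
Proof.
move=> mn F0; rewrite (big_cat_nat (n := m)) //= [X in _ + X]big_nat_cond.
by rewrite [X in _ + X]big1 ?addr0 // => y; rewrite andbT => /F0.
Qed.

Lemma big_nat_mulD (R : Type) (idx : R) (op : Monoid.law idx) n k (F : nat -> R) :
  \big[op/idx]_(0 <= y < n * k) F y =
  \big[op/idx]_(0 <= q < n) \big[op/idx]_(0 <= r < k) F (q * k + r)%N.
Proof.
rewrite big_nat_mul; apply: eq_bigr => q _.
rewrite -{1}[(q * k)%N]add0n big_addn mulSn addnK.
by apply: eq_bigr => r _; rewrite addnC.
Qed.

Lemma sum_nat_multiples (R : nmodType) n k (F : nat -> R) : (0 < k)%N ->
  (forall y, ~~ (k %| y)%N -> F y = 0) ->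
  \sum_(0 <= y < n * k) F y = \sum_(0 <= q < n) F (q * k)%N.
Proof.
move=> k0 F0; rewrite big_nat_mulD; apply: eq_bigr => q _.
rewrite -[k in index_iota _ k]prednK // big_nat_recl //= addn0 [X in _ + X]big_nat [X in _ + X]big1 ?addr0 //.
move=> r /andP[_ rk]; apply: F0; rewrite dvdn_addr ?dvdn_mull //.
by apply/negP => /dvdn_leq; lia.
Qed.

(* For 0 < c < d, psi d c y = (-1)^j if y = |2 d j + c| for some integer j, and
   0 otherwise; in particular psi 3 1 is the Kronecker symbol (12/.). *)
Definition psi (d c y : nat) : int :=
  (-1) ^+ (y %/ d.*2)%N
  * ((y %% d.*2 == c)%N%:R - (y %% d.*2 == d.*2 - c)%N%:R).

(** At most one term is nonzero, at the square root of [D]; as a sum it lets products expand into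
    double sums. *)
Definition sqsum (w : nat -> int) (D : nat) : int :=
  \sum_(0 <= y < D.+1) (if (y * y == D)%N then w y else 0).

Lemma sqsumE B w D : (D < B * B)%N ->
  sqsum w D = \sum_(0 <= y < B) (if (y * y == D)%N then w y else 0).
Proof.
move=> DB; transitivity
    (\sum_(0 <= y < D.+1 + B) (if (y * y == D)%N then w y else 0)).
  rewrite [RHS](@sum_nat_trunc _ D.+1) //; first lia.
  by move=> y yD; case: eqP => // E; nia.
apply: sum_nat_trunc; first lia.
by move=> y yD; case: eqP => // E; nia.
Qed.

Lemma coef_signM i (p : {poly int}) N :
  ((-1) ^+ i * p)`_N = (-1) ^+ i * p`_N.
Proof.
by elim: i p => [|i IHi] p; rewrite ?mul1r // !exprSr -!mulrA IHi !mulN1r coefN.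
Qed.

(** Completing the square: with d = 2 b + c, the exponents e of the terms i and -(i + 1) satisfy 8 d
    e + c^2 = (2 d i + c)^2 and (2 d (i + 1) - c)^2 respectively. *)
Lemma theta_coef b c n N : (0 < b)%N -> (0 < c)%N -> (N < n)%N ->
  (theta_sum (b + c) b n (fun=> 1) (fun=> 1))`_N =
  sqsum (psi (b + c + b) c) (8 * (b + c + b) * N + c * c).
Proof.
move=> b0 c0 Nn; set d := (b + c + b)%N.
rewrite (@sqsumE (n.+1 * d.*2)); last by rewrite /d; nia.
rewrite big_nat_mulD /theta_sum coefD !coef_sum.
(* A zero term at i = n pads the second sum, so that both terms of index i face the block of length
   2 d starting at 2 d i. *)
have -> (F : nat -> int) : \sum_(0 <= i < n) F i = \sum_(0 <= i < n.+1) if (i < n)%N then F i else 0.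
  by rewrite [RHS]big_nat_recr //= ltnn addr0; apply: eq_big_nat => i /andP[_ ->].
rewrite -big_split; apply: eq_big_nat => i /andP[_ iN].
transitivity (\sum_(0 <= r < d.*2 | r == c)
                (if ((i * d.*2 + r) * (i * d.*2 + r) == 8 * d * N + c * c)%N
                 then (-1) ^+ i else 0 : int)
            + \sum_(0 <= r < d.*2 | r == (d.*2 - c)%N)
                (if ((i * d.*2 + r) * (i * d.*2 + r) == 8 * d * N + c * c)%N
                 then - (-1) ^+ i else 0 : int)).
  rewrite !big_nat1_eq.
  have -> : (0 <= c < d.*2)%N by rewrite /d; lia.
  have -> : (0 <= d.*2 - c < d.*2)%N by rewrite /d; lia.
  have C2 : (i * i = 'C(i, 2) + 'C(i, 2) + i)%N.
    by elim: {iN} i => // i IHi; rewrite binS bin1; nia.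
  have sqE y M : (y * y = 8 * d * M + c * c)%N ->
      (y * y == 8 * d * N + c * c)%N = (N == M).
    by move=> ->; rewrite eqn_add2r eqn_pmul2l 1?eq_sym // /d; lia.
  rewrite !mulr1 !coef_signM !coefXn; congr (_ + _).
    rewrite (sqE _ (d * 'C(i, 2) + (b + c) * i)%N); last first.
      transitivity (4 * d * d * (i * i) + 4 * d * c * i + c * c)%N; first lia.
      by rewrite C2 /d; lia.
    by rewrite -/d; case: eqP; rewrite ?mulr1 ?mulr0.
  rewrite (sqE _ (d * 'C(i.+1, 2) + b * i.+1)%N); last first.
    transitivity (4 * d * d * (i * i + i + i + 1) - 4 * d * c * i.+1 + c * c)%N.
      have [e -> cE] : exists2 e, d = (c + e)%N & (0 < e)%N.
        by exists (b + b)%N; rewrite /d; lia.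
      have -> : (i * (c + e).*2 + ((c + e).*2 - c) = i * (c + e).*2 + (c + e + e))%N.
        lia.
      nia.
    by rewrite C2 binS bin1 /d; nia.
  (* An exponent equal to N < n forces i < n, so the padding loses no term. *)
  rewrite -/d; case: eqP => [E|_]; rewrite ?mulr1 ?mulr0 ?exprS ?mulN1r //.
    by rewrite ifT //; nia.
  by case: ifP.
rewrite [in LHS]big_mkcond [X in _ + X]big_mkcond -big_split /=.
apply: eq_big_nat => r /andP[_ rd]; rewrite /psi divnMDl; last lia.
rewrite divn_small // addn0 modnMDl modn_small //.
case: (r =P c) => [->|_].
  have -> : (c == d.*2 - c)%N = false by rewrite /d; lia.
  by rewrite subr0 mulr1; case: ifP; rewrite ?addr0.
by case: ifP => _; case: ifP => _; rewrite ?sub0r ?subr0 ?mulrN1 ?mulr0 ?addr0 ?add0r.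
Qed.

Lemma psi_mod d c y : (0 < d)%N -> psi d c y = psi d c (y %% (d.*2 * 2))%N.
Proof.
move=> d0; rewrite {1}(divn_eq y (d.*2 * 2)) /psi.
have -> : (y %/ (d.*2 * 2) * (d.*2 * 2) = (y %/ (d.*2 * 2) * 2) * d.*2)%N by lia.
by rewrite divnMDl ?double_gt0 // modnMDl exprD mulnC exprM sqrrN !expr1n mul1r.
Qed.

(** * The pentagonal number theorem and the classes 1, 3, 4 modulo 5 of f_1 *)

Lemma qP_split t n :
  qP 1 1 (n * t) = \prod_(0 <= r < t) qP t r.+1 n.
Proof.
rewrite /qP big_nat_mulD exchange_big /=.
apply: eq_bigr => r _; apply: eq_bigr => q _.
by congr (1 - 'X^_); lia.
Qed.

Lemma f1_coef n N : (n <= N)%N -> f 1 n = (qP 1 1 N)`_n.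
Proof.
move=> nN; rewrite -(f_stable _ nN) // /qP big_add1 /=; congr ((polyseq _)`_n).
by apply: eq_bigr => k _; rewrite !mul1n addn1.
Qed.

Lemma f_coef j n : (0 < j)%N ->
  f j n = if (j %| n)%N then f 1 (n %/ j)%N else 0.
Proof.
move=> j0; rewrite (@f1_coef _ n) ?leq_div // -coef_comp_poly_Xn // qP_comp.
rewrite /f /qP big_add1 /=; congr ((polyseq _)`_n).
by apply: eq_bigr => k _; congr (1 - 'X^_); lia.
Qed.

(** The triple product at a = 2, b = 1, whose three factors are the residue classes modulo 3 of the
    factors of f_1. *)
Lemma pentagonal N : f 1 N = sqsum (psi 3 1) (24 * N + 1)%N.
Proof.
rewrite (@f1_coef _ (N.+1 * 3)) ?qP_split; last lia.
rewrite -[RHS](@theta_coef 1 1 N.+1) // -(@jacobi 2 1) //.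
by rewrite !big_nat_recl // big_geq // mulr1 mulrCA !mulrA.
Qed.

Lemma sqsum0 w D : (forall y, (y * y)%N = D -> w y = 0) -> sqsum w D = 0.
Proof. by move=> w0; rewrite /sqsum big1 // => y _; case: eqP => // /w0. Qed.

Lemma sqn_mod5 y :
  [\/ (y %% 5 = 0 /\ y * y %% 5 = 0)%N,
      ((y %% 5 = 1 \/ y %% 5 = 4) /\ y * y %% 5 = 1)%N |
      ((y %% 5 = 2 \/ y %% 5 = 3) /\ y * y %% 5 = 4)%N].
Proof.
rewrite -modnMm; have : (y %% 5 < 5)%N by rewrite ltn_mod.
by case: (y %% 5)%N => [|[|[|[|[|]]]]] // _;
  [apply: Or31 | apply: Or32 | apply: Or33 | apply: Or33 | apply: Or32]; auto.
Qed.

(** 24 (5 m + 3) + 1 is 3 modulo 5, not a square; for the class 4 below the residue is 2, again not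
    a square. *)
Lemma f1_mod3 m : f 1 (5 * m + 3)%N = 0.
Proof. by rewrite pentagonal sqsum0 // => y E; case: (sqn_mod5 y); lia. Qed.

Lemma f1_mod4 m : f 1 (5 * m + 4)%N = 0.
Proof. by rewrite pentagonal sqsum0 // => y E; case: (sqn_mod5 y); lia. Qed.

(** Multiplicativity of (12/.) with (12/5) = -1, checked on one period 12. *)
Lemma psi3_mul5 z : psi 3 1 (z * 5)%N = - psi 3 1 z.
Proof.
rewrite psi_mod // [in RHS]psi_mod // -modnMml.
have : (z %% (3.*2 * 2) < 12)%N by rewrite ltn_mod.
move: (z %% _)%N => r r12.
have /allP/(_ r) : all (fun r => psi 3 1 (r * 5 %% (3.*2 * 2))%N == - psi 3 1 r)
                 (iota 0 12) by vm_compute.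
by rewrite mem_iota => /(_ r12)/eqP.
Qed.

(** A root of y^2 = 120 m + 25 is y = 5 z, which forces 5 | m and z^2 = 24 (m / 5) + 1; the sign
    comes from [psi3_mul5]. *)
Lemma f1_mod1 m : f 1 (5 * m + 1)%N = - f 5 m.
Proof.
rewrite pentagonal (@sqsumE ((120 * m + 26) * 5)); last nia.
rewrite sum_nat_multiples //; last by move=> y y5; case: eqP => // E; case: (sqn_mod5 y); lia.
rewrite f_coef //; case: ifP => m5.
  rewrite pentagonal (@sqsumE (120 * m + 26)) -?sumrN; last nia.
  apply: eq_bigr => z _; rewrite psi3_mul5.
  have -> : (z * 5 * (z * 5) == 24 * (5 * m + 1) + 1)%N
            = (z * z == 24 * (m %/ 5) + 1)%N by lia.
  by case: ifP; rewrite ?oppr0.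
by rewrite oppr0 big1 // => z _; case: eqP => // E; lia.
Qed.

(** * Cancellation of signed representations by x^2 + 3 y^2 *)

(* Rotation of x + y sqrt(-3) by 60 degrees, up to the signs of the coordinates,
   in the one direction that keeps both of them odd. *)
Definition hexrot (p : (nat * nat)%type) : (nat * nat)%type :=
  if (4 %| p.1 + p.2)%N then
    ((p.1 + 3 * p.2)./2, ((p.1 - p.2) + (p.2 - p.1))./2)%N
  else (((p.1 - 3 * p.2) + (3 * p.2 - p.1))./2, (p.1 + p.2)./2)%N.

Lemma hexrot_odd p : odd p.1 -> odd p.2 ->
  odd (hexrot p).1 /\ odd (hexrot p).2.
Proof. by case: p => x y; rewrite /hexrot /=; case: ifP => /=; lia. Qed.

(** Up to signs, the inverse rotation is again a rotation by 60 degrees, and only one direction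
    keeps both coordinates odd. *)
Lemma hexrotK p : odd p.1 -> odd p.2 -> hexrot (hexrot p) = p.
Proof.
case: p => x y; rewrite /hexrot /= => x1 y1.
by case xy4: (4 %| x + y)%N => /=; case: ifP => ? /=; congr (_, _); lia.
Qed.

Lemma hexrot_norm p : odd p.1 -> odd p.2 ->
  ((hexrot p).1 * (hexrot p).1 + 3 * ((hexrot p).2 * (hexrot p).2) =
   p.1 * p.1 + 3 * (p.2 * p.2))%N.
Proof.
case: p => x y; rewrite /hexrot /= => x1 y1.
(* The factor 4 clears the halves; the cases below resolve the absolute values. *)
suff norm4 u v : (4 * (u * u + 3 * (v * v)) = 4 * (x * x + 3 * (y * y)))%N ->
    (u * u + 3 * (v * v) = x * x + 3 * (y * y))%N.
  case: ifP => /= ?; apply: norm4.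
    set u := _./2; set v := _./2.
    have uE : (2 * u = x + 3 * y)%N by rewrite /u; lia.
    case/orP: (leq_total x y) => xy.
      have : (2 * v + x = y)%N by rewrite /v; lia.
      nia.
    have : (2 * v + y = x)%N by rewrite /v; lia.
    nia.
  set u := _./2; set v := _./2.
  have vE : (2 * v = x + y)%N by rewrite /v; lia.
  case/orP: (leq_total x (3 * y)) => xy.
    have : (2 * u + x = 3 * y)%N by rewrite /u; lia.
    nia.
  have : (2 * u + 3 * y = x)%N by rewrite /u; lia.
  nia.
by lia.
Qed.

(** The sign s = 1 serves E_0, and s = -1 serves E_2. *)
Definition weight (s : int) (x y : nat) : int :=
  psi 3 1 x * (psi 5 1 y + s * psi 5 3 y).

(** 60 is the least common multiple of 12 and 20, periods of [psi 3 1] and [psi 5 c]. *)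
Lemma weight_mod s x y u v : (x = u %[mod 60])%N -> (y = v %[mod 60])%N ->
  weight s x y = weight s u v.
Proof.
move=> xu yv; rewrite /weight.
have -> : psi 3 1 x = psi 3 1 u.
  by rewrite psi_mod // [RHS]psi_mod //; congr psi; rewrite /=; lia.
have e5 c : psi 5 c y = psi 5 c v.
  by rewrite psi_mod // [RHS]psi_mod //; congr psi; rewrite /=; lia.
by rewrite !e5.
Qed.

Lemma psi_even d c y : odd c -> (c <= d)%N -> ~~ odd y -> psi d c y = 0.
Proof.
move=> c1 cd y0; have : ~~ odd (y %% d.*2)%N by rewrite odd_mod ?odd_double.
rewrite /psi; move: (y %% _)%N => r r0.
have -> : (r == c) = false by lia.
have -> : (r == d.*2 - c)%N = false by lia.
by rewrite subrr mulr0.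
Qed.

Definition norm5 (x y : nat) : nat :=
  ((x %% 5) * (x %% 5) + 3 * ((y %% 5) * (y %% 5))) %% 5.

Lemma norm5E x y : norm5 x y = ((x * x + 3 * (y * y)) %% 5)%N.
Proof.
by rewrite /norm5 -modnDm modnMm -[(3 * (_ %% 5 * _) %% 5)%N]modnMmr modnMm
           modnMmr modnDm.
Qed.

(* The residues modulo 120 of [x] and [y] determine those modulo 60 of their
   images, up to the sign of the coordinate that is an absolute value. *)
Definition weight_check (s : int) (r : nat) :=
  all (fun x => all (fun y =>
    if ~~ [&& odd x, odd y & norm5 x y == r] then true
    else if (4 %| x + y)%N then
      (weight s (x + 3 * y)./2 (x + 120 - y)./2 == - weight s x y) &&
      (weight s (x + 3 * y)./2 (y + 120 - x)./2 == - weight s x y)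
    else
      (weight s (x + 360 - 3 * y)./2 (x + y)./2 == - weight s x y) &&
      (weight s (3 * y + 120 - x)./2 (x + y)./2 == - weight s x y))
    (iota 0 120)) (iota 0 120).

(** The residues 3 and 2 are those of D = 120 N + 28, for E_0, and D = 120 N + 52, for E_2. In the
    check the offsets 120 and 360 prevent truncated subtraction and halve to multiples of 60. *)
Lemma weight_check1 : weight_check 1 3. Proof. by vm_compute. Qed.
Lemma weight_checkN1 : weight_check (-1) 2. Proof. by vm_compute. Qed.

Lemma weight_hexrot s r p : weight_check s r -> odd p.1 -> odd p.2 ->
  ((p.1 * p.1 + 3 * (p.2 * p.2)) %% 5 = r)%N ->
  weight s (hexrot p).1 (hexrot p).2 = - weight s p.1 p.2.
Proof.
case: p => x y /= chk x1 y1 xy.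
pose u := (x %% 120)%N; pose v := (y %% 120)%N.
have u120 : (u < 120)%N by rewrite ltn_mod.
have v120 : (v < 120)%N by rewrite ltn_mod.
have uv : norm5 u v = r.
  rewrite -xy -norm5E /norm5 (_ : u %% 5 = x %% 5)%N; last by rewrite /u; lia.
  by rewrite (_ : v %% 5 = y %% 5)%N // /v; lia.
have {chk} := chk; rewrite /weight_check.
move/allP/(_ u); rewrite mem_iota => /(_ u120)/allP/(_ v).
rewrite mem_iota => /(_ v120); rewrite uv eqxx.
have -> : odd u by rewrite /u; lia.
have -> : odd v by rewrite /v; lia.
have -> /= : (4 %| u + v)%N = (4 %| x + y)%N by rewrite /u /v; lia.
have -> : weight s u v = weight s x y by apply: weight_mod; rewrite /u /v; lia.
rewrite /hexrot /=; case: ifP => xy4 /= /andP[/eqP E1 /eqP E2].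
  case/orP: (leq_total x y) => le_xy.
    by rewrite -E2; apply: weight_mod; rewrite /u /v; lia.
  by rewrite -E1; apply: weight_mod; rewrite /u /v; lia.
case/orP: (leq_total x (3 * y)) => le_xy.
  by rewrite -E2; apply: weight_mod; rewrite /u /v; lia.
by rewrite -E1; apply: weight_mod; rewrite /u /v; lia.
Qed.

Lemma weight_odd s x y : weight s x y != 0 -> odd x && odd y.
Proof.
rewrite /weight; have [x1|x0] := boolP (odd x); last first.
  by rewrite psi_even // mul0r eqxx.
have [y1|y0] // := boolP (odd y).
by rewrite !(psi_even _ _ y0) // mulr0 addr0 mulr0 eqxx.
Qed.

Definition norm_sum (w : nat -> nat -> int) (B D : nat) : int :=
  \sum_(0 <= x < B) \sum_(0 <= y < B)
    (if (x * x + 3 * (y * y) == D)%N then w x y else 0).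

(** [hexrot] permutes the odd representations of [D] and negates their weights, so the sum is its
    own opposite; [D < B] puts them all in the box. *)
Lemma norm_sum_weight s r D B : weight_check s r -> (D %% 5 = r)%N -> (D < B)%N ->
  norm_sum (weight s) B D = 0.
Proof.
move=> chk Dr DB; rewrite /norm_sum.
rewrite -(big_allpairs (F := fun p => if (p.1 * p.1 + 3 * (p.2 * p.2) == D)%N
                                      then weight s p.1 p.2 else 0)).
set box := [seq _ | _ <- _, _ <- _].
pose good (p : (nat * nat)%type) :=
  [&& odd p.1, odd p.2 & (p.1 * p.1 + 3 * (p.2 * p.2) == D)%N].
pose S := [seq p <- box | good p].
transitivity (\sum_(p <- S) weight s p.1 p.2).
  rewrite /S big_filter [RHS]big_mkcond; apply: eq_bigr => -[x y] _ /=.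
  rewrite /good /=; have [->|/weight_odd] := eqVneq (weight s x y) 0.
    by rewrite !if_same.
  by case/andP => -> ->.
have memS p : (p \in S) = good p.
  rewrite mem_filter; case gp: (good p) => //=; case: p gp => x y /and3P[_ _ /eqP /= E].
  by apply: allpairs_f; rewrite mem_index_iota; nia.
have uS : uniq S.
  by apply: filter_uniq; apply: allpairs_uniq; rewrite ?iota_uniq // => -[? ?] [].
have hS p : p \in S -> hexrot p \in S.
  rewrite !memS => /and3P[x1 y1 /eqP E]; have [h1 h2] := hexrot_odd x1 y1.
  by rewrite /good h1 h2 hexrot_norm // E eqxx.
have hK p : p \in S -> hexrot (hexrot p) = p.
  by rewrite memS => /and3P[x1 y1 _]; apply: hexrotK.
have pS : perm_eq S (map hexrot S).
  apply: uniq_perm => //.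
    by rewrite map_inj_in_uniq // => p q /hK {2}<- /hK {2}<- ->.
  move=> p; apply/idP/mapP => [Sp|[q Sq ->]]; last exact: hS.
  by exists (hexrot p); rewrite ?hS ?hK.
have : \sum_(p <- S) weight s p.1 p.2 = - \sum_(p <- S) weight s p.1 p.2.
  rewrite {1}(perm_big _ pS) /= big_map -sumrN !big_seq.
  apply: eq_bigr => p; rewrite memS => /and3P[x1 y1 /eqP E].
  by apply: (weight_hexrot chk); rewrite ?E.
by lia.
Qed.

(** * The components E_0 and E_2 against theta series *)

(** Adding x^2 = 120 i + u to three times y^2 = 40 (N - i) + v eliminates i. Conversely, the residue
    of y^2 modulo 40 and u < 120 recover i in range. *)
Lemma sqsum_conv w w' u v N B : (u < 120)%N ->
  (forall y, w' y != 0 -> (y * y %% 40 = v)%N) -> (120 * N + u + 3 * v < B)%N ->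
  \sum_(i < N.+1) sqsum w (120 * i + u) * sqsum w' (40 * (N - i) + v) =
  norm_sum (fun x y => w x * w' y) B (120 * N + u + 3 * v).
Proof.
move=> u120 wv NB; rewrite /norm_sum.
transitivity (\sum_(i < N.+1) \sum_(0 <= x < B) \sum_(0 <= y < B)
   (if ((x * x == 120 * i + u) && (y * y == 40 * (N - i) + v))%N
    then w x * w' y else 0)).
  apply: eq_bigr => i _; have iN := ltn_ord i.
  rewrite !(@sqsumE B); [|nia|nia].
  rewrite mulr_suml; apply: eq_bigr => x _; rewrite mulr_sumr.
  by apply: eq_bigr => y _; do 2!case: eqP => _ /=; rewrite ?mul0r ?mulr0.
rewrite exchange_big; apply: eq_bigr => x _.
rewrite exchange_big; apply: eq_bigr => y _ /=.
have [w0|/wv yv] := eqVneq (w' y) 0.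
  by rewrite w0 mulr0 if_same big1 // => i _; rewrite if_same.
case: eqP => E; last by rewrite big1 // => i _; case: ifP => //; have := ltn_ord i; lia.
have jN : (y * y %/ 40 <= N)%N by lia.
(* The only contributing index, solved from y^2 = 40 (N - i) + v. *)
have iN : (N - y * y %/ 40 < N.+1)%N by lia.
rewrite (bigD1 (Ordinal iN)) //= ifT; last by lia.
rewrite big1 ?addr0 // => i /eqP ne_i; case: ifP => // ie; case: ne_i; apply: val_inj => /=.
by have := ltn_ord i; lia.
Qed.

(** If y = 10 q + c or 10 q - c, then y^2 - c^2 is 20 q (5 q + c) or 20 q (5 q - c), where the
    factor after 20 is even because c is odd. *)
Lemma psi5_sq c y : (c == 1)%N || (c == 3)%N -> psi 5 c y != 0 ->
  (y * y %% 40 = c * c)%N.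
Proof.
move=> c13; rewrite /psi /= => nz.
have {nz} : (y %% 10 == c)%N || (y %% 10 == 10 - c)%N.
  apply: contraNT nz; rewrite negb_or => /andP[/negbTE -> /negbTE ->].
  by rewrite subrr mulr0.
rewrite {3 4}(divn_eq y 10); move: (y %/ 10)%N (y %% 10)%N => q r.
have [k [kE | kE]] : exists k, q = k.*2 \/ q = k.*2.+1.
  by exists q./2; lia.
all: case/orP: c13 => /eqP -> /orP[] /eqP ->; rewrite kE; nia.
Qed.

(** The series f_5 [2] [3] for c = 1 and f_5 [1] [4] for c = 3. *)
Definition theta5 (c : nat) : fps int := fun N => sqsum (psi 5 c) (40 * N + c * c).

Lemma norm_sumD w1 w2 B D :
  norm_sum w1 B D + norm_sum w2 B D = norm_sum (fun x y => w1 x y + w2 x y) B D.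
Proof.
rewrite /norm_sum -big_split; apply: eq_bigr => x _ /=.
by rewrite -big_split; apply: eq_bigr => y _ /=; case: ifP; rewrite ?addr0.
Qed.

(** Here 24 (5 m + r) + 1 = 120 m + (24 r + 1); the bound 200 exceeds 97 + 27, the largest
    constant. *)
Lemma dissection_conv r c N : (r < 5)%N -> (c == 1)%N || (c == 3)%N ->
  fps_mul (fun m => f 1 (5 * m + r)%N) (theta5 c) N =
  norm_sum (fun x y => psi 3 1 x * psi 5 c y) (120 * N + 200)
           (120 * N + (24 * r + 1) + 3 * (c * c)).
Proof.
move=> r5 c13; rewrite -sqsum_conv => [||y|]; last 3 first.
- by lia.
- exact: psi5_sq.
- by case/orP: c13 => /eqP ->; lia.
by apply: eq_bigr => i _; rewrite pentagonal; congr (sqsum _ _ * _); lia.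
Qed.

(** Since -f_5 is the class 1 of f_1, products with f_5 become signed representation counts too. *)
Lemma fps_mul_f5 c N :
  fps_mul (f 5) (theta5 c) N = - fps_mul (fun m => f 1 (5 * m + 1)%N) (theta5 c) N.
Proof.
by rewrite /fps_mul -sumrN; apply: eq_bigr => i _; rewrite f1_mod1 mulNr opprK.
Qed.

(** Both products concern D = 120 N + 28, as 28 = 1 + 27 = 25 + 3; their difference is the sum of
    [weight 1]. *)
Lemma quintuple0 N :
  fps_mul (fun m => f 1 (5 * m + 0)%N) (theta5 3) N = fps_mul (f 5) (theta5 1) N.
Proof.
apply/eqP; rewrite fps_mul_f5 -addr_eq0 !dissection_conv //.
rewrite (_ : _ + 3 * (1 * 1) = 120 * N + (24 * 0 + 1) + 3 * (3 * 3))%N; last by lia.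
rewrite norm_sumD -[X in _ == X](@norm_sum_weight 1 3 (120 * N + (24 * 0 + 1) + 3 * (3 * 3))
  (120 * N + 200)) ?weight_check1 //; [|lia|lia].
apply/eqP; apply: eq_bigr => x _; apply: eq_bigr => y _.
by case: ifP => // _; rewrite /weight mul1r mulrDr addrC.
Qed.

(** Here 52 = 49 + 3 = 25 + 27, and the combined weight is [weight (-1)]. *)
Lemma quintuple2 N :
  fps_mul (fun m => f 1 (5 * m + 2)%N) (theta5 1) N = - fps_mul (f 5) (theta5 3) N.
Proof.
apply/eqP; rewrite fps_mul_f5 opprK -subr_eq0 !dissection_conv //.
rewrite (_ : _ + 3 * (3 * 3) = 120 * N + (24 * 2 + 1) + 3 * (1 * 1))%N; last by lia.
have norm_sumN w B D : - norm_sum w B D = norm_sum (fun x y => - w x y) B D.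
  rewrite /norm_sum -sumrN; apply: eq_bigr => x _; rewrite -sumrN.
  by apply: eq_bigr => y _; case: ifP; rewrite ?oppr0.
rewrite norm_sumN norm_sumD.
rewrite -[X in _ == X](@norm_sum_weight (-1) 2 (120 * N + (24 * 2 + 1) + 3 * (1 * 1))
  (120 * N + 200)) ?weight_checkN1 //; [|lia|lia].
apply/eqP; apply: eq_bigr => x _; apply: eq_bigr => y _.
by case: ifP => // _; rewrite /weight mulN1r mulrDr mulrN.
Qed.

(** * Product forms of E_0 and E_2 *)

Definition trunc (N : nat) (u : fps int) : {poly int} := \poly_(i < N) u i.

Lemma coef_trunc N u i : (i < N)%N -> (trunc N u)`_i = u i.
Proof. by move=> iN; rewrite coef_poly iN. Qed.

Lemma trunc_mul N u v : eqX N (trunc N (fps_mul u v)) (trunc N u * trunc N v).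
Proof.
move=> i iN; rewrite coef_trunc // coefM; apply: eq_bigr => j _.
by have ji := ltn_ord j; rewrite !coef_trunc //; lia.
Qed.

Lemma eq_trunc N u v : u =1 v -> trunc N u = trunc N v.
Proof. by move=> uv; apply: eq_poly => i _. Qed.

Lemma trunc_opp N u : trunc N (fun n => - u n) = - trunc N u.
Proof. by apply/polyP => i; rewrite coefN !coef_poly; case: ifP; rewrite ?oppr0. Qed.

Lemma trunc_comp N k u : (0 < k)%N ->
  eqX N (trunc N (fun m => if (k %| m)%N then u (m %/ k)%N else 0))
        (trunc N u \Po 'X^k).
Proof.
move=> k0 i iN; rewrite coef_trunc // coef_comp_poly_Xn //; case: ifP => // _.
by rewrite coef_trunc // (leq_ltn_trans _ iN) ?leq_div.
Qed.

Lemma trunc_f1 N t : (0 < t)%N ->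
  eqX N (trunc N (f 1)) (\prod_(0 <= r < t) qP t r.+1 N).
Proof.
by move=> t0 i iN; rewrite coef_trunc // -qP_split -f1_coef //; nia.
Qed.

Lemma trunc_f5 N : eqX N (trunc N (f 5)) (qP 5 5 N).
Proof.
move=> i iN; rewrite coef_trunc // f_coef // -[qP 5 5 N](qP_comp 1 1 N 5).
rewrite coef_comp_poly_Xn //; case: ifP => // _.
by rewrite -f1_coef // (leq_trans (leq_div _ _)) // ltnW.
Qed.

Lemma trunc_theta51 N :
  eqX N (trunc N (theta5 1)) (qP 5 2 N * qP 5 3 N * qP 5 5 N).
Proof.
move=> i iN; rewrite coef_trunc // [qP 5 2 N * _]mulrC.
by rewrite (@jacobi 3 2) // (@theta_coef 2 1).
Qed.

Lemma trunc_theta53 N :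
  eqX N (trunc N (theta5 3)) (qP 5 1 N * qP 5 4 N * qP 5 5 N).
Proof.
move=> i iN; rewrite coef_trunc // [qP 5 1 N * _]mulrC.
by rewrite (@jacobi 4 1) // (@theta_coef 1 3).
Qed.

(** Both theta series in [quintuple0] contain f_5, and one copy cancels. *)
Lemma dissection0 N : let E := trunc N (fun m => f 1 (5 * m + 0)%N) in
  eqX N (E * (qP 5 1 N * qP 5 4 N)) (qP 5 5 N * (qP 5 2 N * qP 5 3 N)).
Proof.
move=> E; apply: (@eqX_mulI _ (qP 5 5 N)); first exact: qP_coef0.
apply: (@eqX_trans _ (E * trunc N (theta5 3))).
  rewrite mulrCA; apply: eqXM => //; apply: eqX_sym; rewrite mulrC.
  exact: trunc_theta53.
apply: eqX_trans (eqX_sym (trunc_mul _ _)) _.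
rewrite (eq_trunc N quintuple0); apply: eqX_trans (trunc_mul _ _) _.
apply: eqXM; first exact: trunc_f5.
by rewrite mulrC; apply: trunc_theta51.
Qed.

Lemma dissection2 N : let E := trunc N (fun m => f 1 (5 * m + 2)%N) in
  eqX N (E * (qP 5 2 N * qP 5 3 N)) (- qP 5 5 N * (qP 5 1 N * qP 5 4 N)).
Proof.
move=> E; apply: (@eqX_mulI _ (qP 5 5 N)); first exact: qP_coef0.
apply: (@eqX_trans _ (E * trunc N (theta5 1))).
  rewrite mulrCA; apply: eqXM => //; apply: eqX_sym; rewrite mulrC.
  exact: trunc_theta51.
apply: eqX_trans (eqX_sym (trunc_mul _ _)) _.
rewrite (eq_trunc N quintuple2) trunc_opp mulNr mulrN => i iN.
rewrite !coefN; congr (- _); move: i iN; apply: eqX_trans (trunc_mul _ _) _.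
rewrite [X in eqX _ _ (_ * X)]mulrC; apply: eqXM; first exact: trunc_f5.
exact: trunc_theta53.
Qed.

(** * Residue classes modulo 5 of f_2 / f_5 *)

(** f_5 is f_1 in q^5, so multiplication by f_5 respects residue classes of exponents modulo 5. *)
Lemma section5 r m : (r < 5)%N ->
  fps_mul (fun k => a_2p1_5m1 (5 * k + r)%N) (f 1) m = f 2 (5 * m + r)%N.
Proof.
move=> r5; have f50 : f 5 0%N \is a GRing.unit by rewrite f_coef0 unitr1.
rewrite -(fps_divK (f 2) f50) -/a_2p1_5m1 /fps_mul.
rewrite -[RHS](big_mkord xpredT (fun i => a_2p1_5m1 i * f 5 (5 * m + r - i)%N)).
rewrite -[LHS](big_mkord xpredT (fun i => a_2p1_5m1 (5 * i + r)%N * f 1 (m - i)%N)).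
set n := (5 * m + r)%N.
transitivity (\sum_(0 <= k < n.+1) a_2p1_5m1 (n - k)%N * f 5 k); last first.
  rewrite big_nat_rev /= !add0n; apply: eq_big_nat => k kn.
  by rewrite subSS subKn //; lia.
have f5_0 k : ~~ (5 %| k)%N -> a_2p1_5m1 (n - k)%N * f 5 k = 0.
  by move=> k5; rewrite f_coef // (negbTE k5) mulr0.
(* The range grows up to 5 (m + 1); since r < 5, no added index is a multiple of 5. *)
rewrite -[RHS](@sum_nat_trunc _ _ (m.+1 * 5)); [|by rewrite /n; lia|]; last first.
  by move=> k kn; apply: f5_0; move: kn; rewrite /n; lia.
rewrite sum_nat_multiples // big_nat_rev /= !add0n; apply: eq_big_nat => k km.
rewrite subSS subKn; last lia.
rewrite (@f_coef 5) // dvdn_mull // mulnK //; congr (a_2p1_5m1 _ * _); rewrite /n; lia.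
Qed.

(** As f_2 is f_1 in q^2 and 5 (2 k) + 2 s = 2 (5 k + s), the class 2 s of f_2 is the class s of f_1
    in q^2. *)
Lemma section5_even r s N : (r < 5)%N -> r = s.*2 ->
  eqX N (trunc N (fun k => a_2p1_5m1 (5 * k + r)%N) * trunc N (f 1))
        (trunc N (fun m => f 1 (5 * m + s)%N) \Po 'X^2).
Proof.
move=> r5 rs; apply: eqX_trans (eqX_sym (trunc_mul _ _)) _.
rewrite (eq_trunc N (fun m => section5 m r5)).
apply: eqX_trans (trunc_comp _ _) => // i iN; rewrite !coef_trunc // f_coef //.
rewrite (_ : (2 %| 5 * i + r) = (2 %| i))%N; last by lia.
by case: ifP => // i2; congr (f 1 _); lia.
Qed.

(** For m = 2 k + 1, 5 m + 1 = 2 (5 k + 3) and 5 m + 3 = 2 (5 k + 4), so these classes of f_2 vanish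
    with those of f_1; then f_1 cancels. *)
Lemma section5_zero r n : (r == 1)%N || (r == 3)%N ->
  a_2p1_5m1 (5 * n + r)%N = 0.
Proof.
move=> r13; have r5 : (r < 5)%N by lia.
have f2_0 m : f 2 (5 * m + r)%N = 0.
  rewrite f_coef //; case: ifP => // m2; case/orP: r13 => /eqP rE.
    have -> : ((5 * m + r) %/ 2 = 5 * (m %/ 2) + 3)%N by lia.
    exact: f1_mod3.
  have -> : ((5 * m + r) %/ 2 = 5 * (m %/ 2) + 4)%N by lia.
  exact: f1_mod4.
have H : eqX n.+1 (trunc n.+1 (f 1) * trunc n.+1 (fun k => a_2p1_5m1 (5 * k + r)%N))
                  (trunc n.+1 (f 1) * 0).
  rewrite mulr0 mulrC; apply: eqX_trans (eqX_sym (trunc_mul _ _)) _ => i iN.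
  by rewrite coef_trunc // section5 // f2_0 coef0.
have f10 : (trunc n.+1 (f 1))`_0 = 1 by rewrite coef_trunc // f_coef0.
by have := eqX_mulI f10 H (ltnSn n); rewrite coef_trunc // coef0.
Qed.

(** * Signs of the classes 0, 2 and 4 *)

(** Division by [p] is required to preserve strict positivity because 1 / p itself may have zero
    coefficients, as 1 / (1 - q^2) does. *)
Definition div_pos (p : {poly int}) := forall N u v,
  eqX N (u * p) v -> (forall i, (i < N)%N -> 0 < v`_i) ->
  forall i, (i < N)%N -> 0 < u`_i.

Lemma div_pos_1BXn k : (0 < k)%N -> div_pos (1 - 'X^k).
Proof.
move=> k0 N u v uv v0 i; have [m] := ubnP i; elim: m i => // m IHm i im iN.
have := uv i iN; rewrite mulrBr mulr1 coefB coefMXn.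
have := v0 i iN; case: ltnP => ik; first by rewrite subr0 => ? ->.
move=> vi0 /eqP; rewrite subr_eq => /eqP ->.
by apply: addr_gt0 => //; apply: IHm; lia.
Qed.

Lemma div_posM p q : div_pos p -> div_pos q -> div_pos (p * q).
Proof.
move=> ip iq N u v; rewrite mulrA => /iq Q v0; apply: (ip N u (u * p)) => //.
exact: Q.
Qed.

Lemma div_pos_qP d c n : (0 < c)%N -> div_pos (qP d c n).
Proof.
move=> c0; elim: n => [|n IHn]; last first.
  by rewrite qPS; apply: div_posM => //; apply: div_pos_1BXn; lia.
by rewrite /qP big_geq // => N u v; rewrite mulr1 => uv v0 i iN; rewrite uv ?v0.
Qed.

(** The factor 1 - X of [qP d 1 N] yields 1 / (1 - q), with all coefficients 1; dividing by the
    other factors keeps them positive. *)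
Lemma div_qP1_pos d N u p : eqX N (u * qP d 1 N * p) 1 -> div_pos p ->
  forall i, (i < N)%N -> 0 < u`_i.
Proof.
case: N => [//|N] H ip.
have qE : qP d 1 N.+1 = (1 - 'X) * qP d d.+1 N.
  rewrite /qP big_nat_recl // muln0 add0n expr1; congr (_ * _).
  by apply: eq_bigr => i _; congr (1 - 'X^_); lia.
have iq : div_pos (qP d d.+1 N * p).
  by apply: div_posM => //; apply: div_pos_qP.
apply: (iq _ _ (u * (qP d d.+1 N * p))) => //.
have {}H : eqX N.+1 (u * (qP d d.+1 N * p) * (1 - 'X)) 1.
  by rewrite (_ : _ * _ = u * qP d 1 N.+1 * p) // qE; ring.
move=> i iN; have -> : (u * (qP d d.+1 N * p))`_i = 1; last by [].
elim: i iN => [|i IHi] iN; have := H _ iN;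
  rewrite mulrBr mulr1 coefB coefMX coef1 ?subr0 //=.
by move/eqP; rewrite IHi ?subr_eq ?add0r => [/eqP|]; last lia.
Qed.

(** With Q_r = (q^r; q^10)_oo, the class is Q_10 Q_4 Q_6 / (Q_2 Q_8 f_1), and f_1 = Q_1 ... Q_10
    cancels the numerator. *)
Lemma section5_pos0 n : 0 < a_2p1_5m1 (5 * n + 0)%N.
Proof.
pose N := n.+1; pose Q r := qP 10 r N.
set b := fun k => a_2p1_5m1 (5 * k + 0)%N.
rewrite -[a_2p1_5m1 _](@coef_trunc N b) //.
have B := @section5_even 0 0 N isT erefl.
have D := eqX_comp (isT : 0 < 2)%N (@dissection0 N).
rewrite !comp_polyM !qP_comp in D.
apply: (@div_qP1_pos 10 N _ (Q 2 * Q 3 * Q 5 * Q 7 * Q 8 * Q 9 * (Q 2 * Q 8))) => //; last first.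
  by do !apply: div_posM; apply: div_pos_qP.
apply: (@eqX_mulI _ (Q 10 * (Q 4 * Q 6))).
  by rewrite !coef0M !qP_coef0 ?mulr1.
have F := @trunc_f1 N 10 isT.
rewrite !big_nat_recl // big_geq // mulr1 in F.
rewrite mulr1; apply: eqX_trans D.
apply: eqX_sym; apply: eqX_trans (eqXM (eqX_sym B) (@eqX_refl _ _)) _.
apply: eqX_trans (eqXM (eqXM (@eqX_refl _ (trunc N b)) F) (@eqX_refl _ _)) _.
rewrite -/N /Q => i _; congr ((polyseq _)`_i); ring.
Qed.

(** Similarly, the opposite of the class is Q_10 Q_2 Q_8 / (Q_4 Q_6 f_1). *)
Lemma section5_neg4 n : a_2p1_5m1 (5 * n + 4)%N < 0.
Proof.
pose N := n.+1; pose Q r := qP 10 r N.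
set b := fun k => a_2p1_5m1 (5 * k + 4)%N.
rewrite -oppr_gt0 -[a_2p1_5m1 _](@coef_trunc N b) // -coefN.
have B := @section5_even 4 2 N isT erefl.
have D := eqX_comp (isT : 0 < 2)%N (@dissection2 N).
rewrite !comp_polyM raddfN /= !qP_comp in D.
apply: (@div_qP1_pos 10 N _ (Q 3 * Q 4 * Q 5 * Q 6 * Q 7 * Q 9 * (Q 4 * Q 6))) => //; last first.
  by do !apply: div_posM; apply: div_pos_qP.
apply: (@eqX_mulI _ (Q 10 * (Q 2 * Q 8))).
  by rewrite !coef0M !qP_coef0 ?mulr1.
have F := @trunc_f1 N 10 isT.
rewrite !big_nat_recl // big_geq // mulr1 in F.
have {}D := eqXM (@eqX_refl N (-1)) D.
rewrite [X in eqX _ _ X](_ : _ = Q 10 * (Q 2 * Q 8)) in D; last by rewrite /Q; ring.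
rewrite mulr1; apply: eqX_trans D.
have {}B := eqXM (@eqX_refl N (-1)) B.
apply: eqX_sym; rewrite [X in eqX _ X _]mulrA.
apply: eqX_trans (eqXM (eqX_sym B) (@eqX_refl _ _)) _; rewrite [X in X * _]mulrA.
apply: eqX_trans (eqXM (eqXM (@eqX_refl _ (-1 * trunc N b)) F) (@eqX_refl _ _)) _.
rewrite -/N /Q => i _; congr ((polyseq _)`_i); ring.
Qed.

(** By [f1_mod1] the opposite of the class is f_10 / f_1 = 1 / (Q_1 ... Q_9). *)
Lemma section5_neg2 n : a_2p1_5m1 (5 * n + 2)%N < 0.
Proof.
pose N := n.+1; pose Q r := qP 10 r N.
set b := fun k => a_2p1_5m1 (5 * k + 2)%N.
rewrite -oppr_gt0 -[a_2p1_5m1 _](@coef_trunc N b) // -coefN.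
have B := @section5_even 2 1 N isT erefl.
rewrite (eq_trunc N f1_mod1) trunc_opp raddfN /= in B.
have D := eqX_comp (isT : 0 < 2)%N (@trunc_f5 N); rewrite qP_comp in D.
have F := @trunc_f1 N 10 isT.
rewrite !big_nat_recl // big_geq // mulr1 in F.
apply: (@div_qP1_pos 10 N _ (Q 2 * Q 3 * Q 4 * Q 5 * Q 6 * Q 7 * Q 8 * Q 9)) => //; last first.
  by do !apply: div_posM; apply: div_pos_qP.
apply: (@eqX_mulI _ (Q 10)); first by rewrite qP_coef0.
rewrite mulr1; apply: eqX_trans D.
have {}B := eqXM (@eqX_refl N (-1)) B; rewrite !mulN1r opprK in B.
apply: eqX_trans B; apply: eqX_sym; rewrite -mulNr.
apply: eqX_trans (eqXM (@eqX_refl _ (- trunc N b)) F) _.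
rewrite -/N /Q => i _; congr ((polyseq _)`_i); ring.
Qed.

Theorem theorem5p3 (n : nat) :
  [/\ 0 < a_2p1_5m1 (5 * n)%N,
      a_2p1_5m1 (5 * n + 1)%N = 0,
      a_2p1_5m1 (5 * n + 2)%N < 0,
      a_2p1_5m1 (5 * n + 3)%N = 0 &
      a_2p1_5m1 (5 * n + 4)%N < 0].
Proof.
split; [|exact: section5_zero| | exact: section5_zero |].
- by have := section5_pos0 n; rewrite addn0.
- exact: section5_neg2.
exact: section5_neg4.
Qed.
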